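(* Let $F$ be a number field Galois over $\mathbb Q$, $M$ an even integer divisible by the discriminant of $F$, $n\ge1$, $i\mapsto\sigma_i\in\mathrm{Gal}(F/\mathbb Q)$ ($i=1,\dots,n$, $\sigma_1=\mathrm{id}$) a vertical gauge, $p$ a prime not dividing $M$, $\mathfrak P$ a prime of $\mathcal O_F$ dividing $p$, and $q=(q_{ij})\in GL_n(\mathcal O_F[1/M])$ with $q^t=q$. Assume $q$ is vertical gauge invariant, i.e. $\sigma_i(q)=q$ for $i=1,\dots,n$. Let $(\varphi_{ij})$ be the curvature of the vertical Levi-Civita connection attached to $q$ at $\mathfrak P$, $\Phi_{ij}:=\varphi_{ij}(x)$, and let $R_{ijmk}$ be the $(m,k)$ entry of the matrix $x^{(p^2)t}q^{(p^2)}\Phi_{ij}$. With $\delta=\delta^1$ let $$C=(C_{jk}):=-x^{(p)t}\cdot\delta q\cdot x^{(p)}+\frac1p\left\{(x^tqx)^{(p)}-x^{(p)t}q^{(p)}x^{(p)}\right\}.$$ Then for all $i,j,m,k$ the following congruences hold in $\mathcal O(\widehat{G^1})$: $$R_{ijmk}\equiv\tfrac12(C_{ik}+C_{jm}-C_{jk}-C_{im})^p\quad\text{mod }p,$$ $$R_{ijmk}\equiv\tfrac12(\delta q_{jk}+\delta q_{im}-\delta q_{ik}-\delta q_{jm})^p\quad\text{mod }(p,x-1),$$ where $(p,x-1)$ is the ideal generated by $p$, the $x_{ii}-1$, and the $x_{ij}$ for $i\ne j$.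
   Context: For a matrix $a=(a_{ij})$, $a^t$ is the transpose, $a^{(p)}=(a_{ij}^p)$ and $a^{(p^2)}=(a_{ij}^{p^2})$; set maps between rings are applied to matrices entrywise. A Frobenius lift on a ring $A$ is a ring endomorphism reducing mod $p$ to the $p$-power Frobenius of $A/pA$. On a $p$-torsion free ring a $p$-derivation $\delta$ is the same as a Frobenius lift $\phi$, via $\phi(a)=a^p+p\,\delta a$ (''attached''). $\widehat{\ }$ denotes $p$-adic completion. Set $\mathfrak P_i=\sigma_i\mathfrak P$ and let $R_i=\widehat{\mathcal O_{\mathfrak P_i}}$ be the $p$-adic completion of the localization of $\mathcal O_F$ at $\mathfrak P_i$ (a complete discrete valuation ring with maximal ideal generated by the odd prime $p$). It has a unique Frobenius lift $\phi^i$, hence a unique $p$-derivation $\delta^i$. Let $x$ be an $n\times n$ matrix of indeterminates, $G^i=\mathrm{Spec}\,R_i[x,\det(x)^{-1}]$, $\mathcal O(\widehat{G^i})=R_i[x,\det(x)^{-1}]^{\widehat{\ }}$. The automorphism $\sigma_i$ induces an isomorphism $R_1\to R_i$, extended to $\sigma_i:\mathcal O(\widehat{G^1})\to\mathcal O(\widehat{G^i})$ by $\sigma_i(x)=x$. A vertical connection at $\mathfrak P$ is an $n$-tuple $(\delta^1,\dots,\delta^n)$ where $\delta^i$ is a $p$-derivation on $\mathcal O(\widehat{G^i})$ extending that of $R_i$ (same notation), with attached Frobenius lift $\phi^i$. It is metric with respect to $q$ if for every $i$, $\phi^i\circ\mathcal H_q=\mathcal H_q\circ\phi^i_0$, where $\mathcal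 H_q$ is the (continuous) $R_i$-algebra endomorphism of $\mathcal O(\widehat{G^i})$ with $x\mapsto x^tqx$ and $\phi_0^i$ is the Frobenius lift extending that of $R_i$ with $\phi_0^i(x)=x^{(p)}$. With $\gamma_i=(\gamma_{ijk})_{j,k}:=(\delta^ix)^t\cdot\phi^i(q)\cdot x^{(p)}$, it is torsion free relative to $q$ if $\sigma_i^{-1}\gamma_{ijk}=\sigma_j^{-1}\gamma_{jik}$ for all $i,j,k$. The vertical Levi-Civita connection attached to $q$ at $\mathfrak P$ is the unique (it exists) vertical connection that is metric with respect to $q$ and torsion free relative to $q$. Its curvature is the family of additive maps $\varphi_{ij}:\mathcal O(\widehat{G^1})\to\mathcal O(\widehat{G^1})$, $$\varphi_{ij}=\frac1p\{\sigma_i^{-1}\phi^i\sigma_i\sigma_j^{-1}\phi^j\sigma_j-\sigma_j^{-1}\phi^j\sigma_j\sigma_i^{-1}\phi^i\sigma_i\}$$ (composition of maps, rightmost first). *)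

(* Defs.v *)
From HB Require Import structures.
From mathcomp Require Import all_boot all_order all_fingroup all_algebra.
From mathcomp Require Import all_solvable all_field.
From mathcomp Require Import mpoly.
From mathcomp Require Import boolp classical_sets.

Set Implicit Arguments.
Unset Strict Implicit.
Unset Printing Implicit Defensive.

Import GRing.Theory.
Local Open Scope ring_scope.

Section NumberField.

Variable F : splittingFieldType rat.

Definition integers : {pred F} :=
  fun a => `[< integralOver (intr : int -> F) a >].

Lemma integersP (a : F) :
  reflect (integralOver (intr : int -> F) a) (a \in integers).
Proof. exact: asboolP. Qed.

Lemma integers_subring : subring_closed integers.
Proof.
split; first by apply/integersP/integral1.
  by move=> a b /integersP ha /integersP hb; apply/integersP/integral_sub.
by move=> a b /integersP ha /integersP hb; apply/integersP/integral_mul.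
Qed.

HB.instance Definition _ :=
  GRing.isSubringClosed.Build F integers integers_subring.

Record OF : predArgType := MkOF { OF_val :> F; _ : OF_val \in integers }.

HB.instance Definition _ := [isSub for OF_val].
HB.instance Definition _ := [Choice of OF by <:].
HB.instance Definition _ := [SubChoice_isSubComNzRing of OF by <:].

(* O_F[1/M], as a subset of F *)
Definition integers_inv (M : int) : {pred F} :=
  fun a => `[< exists k : nat, M%:~R ^+ k * a \in integers >].

(* q \in GL_N(S), for a subset S of F *)
Definition GL_over (S : {pred F}) (N : nat) (q : 'M[F]_N) : Prop :=
  [/\ q \in unitmx, forall j k, q j k \in S & forall j k, invmx q j k \in S].

Definition is_integral_basis (b : (\dim {:F}).-tuple F) : Prop :=
  [/\ basis_of {:F} b,
      forall i, tnth b i \in integers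
    & forall a, a \in integers ->
        exists c : 'I_(\dim {:F}) -> int, a = \sum_i (c i)%:~R * tnth b i].

Definition is_discriminant (d : int) : Prop :=
  exists2 b, is_integral_basis b &
    d%:~R = \det (\matrix_(i, j) galTrace 1 {:F} (tnth b i * tnth b j)).

Lemma gal_integers (s : gal_of {:F}) (a : OF) : s (val a) \in integers.
Proof.
apply/integersP; have /integersP[r monr ra] := valP a; exists r => //.
have -> : map_poly (intr : int -> F) r =
          map_poly (gal_repr s) (map_poly intr r).
  by rewrite -map_poly_comp; apply: eq_map_poly => m /=; rewrite rmorph_int.
exact: rmorph_root.
Qed.

Definition galOF (s : gal_of {:F}) (a : OF) : OF := MkOF (gal_integers s a).

Section Ideal.
Variables (s : gal_of {:F}) (P : prime_idealr OF).

(* the ideal s P *)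
Definition gal_ideal : {pred OF} :=
  fun a => `[< exists2 b, b \in (P : {pred OF}) & a = galOF s b >].

Let galV (a : OF) := galOF s^-1%g a.

Lemma mem_gal_ideal (a : OF) : (a \in gal_ideal) = (galV a \in (P : {pred OF})).
Proof.
apply/asboolP/idP => [[b Pb ->]|Pa].
  suff -> : galV (galOF s b) = b by [].
  by apply: val_inj; rewrite /= -galM ?memvf // mulgV gal_id.
exists (galV a) => //; apply: val_inj.
by rewrite /= -galM ?memvf // mulVg gal_id.
Qed.

Lemma gal_ideal_closed : idealr_closed gal_ideal.
Proof.
have gD : {morph galV : a b / a + b} by move=> a b; apply: val_inj; rewrite /= raddfD.
have gM : {morph galV : a b / a * b} by move=> a b; apply: val_inj; rewrite /= rmorphM.
have g1 : galV 1 = 1 by apply: val_inj; rewrite /= rmorph1.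
have g0 : galV 0 = 0 by apply: val_inj; rewrite /= raddf0.
split; first by rewrite mem_gal_ideal g0 rpred0.
  by rewrite mem_gal_ideal g1 idealr1.
move=> a u v; rewrite !mem_gal_ideal gD gM => Pu Pv.
by rewrite rpredD // idealMr.
Qed.

HB.instance Definition _ := isIdealr.Build OF gal_ideal gal_ideal_closed.

Lemma gal_ideal_prime : prime_idealr_closed gal_ideal.
Proof.
have gM a b : galV (a * b) = galV a * galV b by apply: val_inj; rewrite /= rmorphM.
by move=> a b; rewrite !mem_gal_ideal gM prime_idealrM.
Qed.

HB.instance Definition _ :=
  isPrimeIdealrClosed.Build OF gal_ideal gal_ideal_prime.

End Ideal.

Section Localization.
Variable P : prime_idealr OF.

(* the localization of O_F at P, as a subset of F *)
Definition loc_integers : {pred F} :=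
  fun a => `[< exists u v : OF, v \notin (P : {pred OF}) /\ a = val u / val v >].

Lemma loc_integers_subring : subring_closed loc_integers.
Proof.
have nz (v : OF) : v \notin (P : {pred OF}) -> val v != 0.
  by apply: contraNneq => v0; rewrite (_ : v = 0) ?rpred0 //; apply: val_inj.
have nP (v w : OF) : v \notin (P : {pred OF}) -> w \notin (P : {pred OF}) ->
    v * w \notin (P : {pred OF}).
  by move=> vP wP; rewrite prime_idealrM negb_or vP.
split.
- apply/asboolP; exists 1, 1; split; first by rewrite idealr1.
  by rewrite rmorph1 divr1.
- move=> _ _ /asboolP[a [v [vP ->]]] /asboolP[b [w [wP ->]]].
  apply/asboolP; exists (a * w - b * v), (v * w); split; first exact: nP.
  by rewrite -mulNr addf_div ?nz // rmorphB !rmorphM mulNr.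
move=> _ _ /asboolP[a [v [vP ->]]] /asboolP[b [w [wP ->]]].
apply/asboolP; exists (a * b), (v * w); split; first exact: nP.
by rewrite mulf_div !rmorphM.
Qed.

HB.instance Definition _ :=
  GRing.isSubringClosed.Build F loc_integers loc_integers_subring.

Record locOF := MkLocOF { locOF_val :> F; _ : locOF_val \in loc_integers }.

HB.instance Definition _ := [isSub for locOF_val].
HB.instance Definition _ := [Choice of locOF by <:].
HB.instance Definition _ := [SubChoice_isSubComNzRing of locOF by <:].

Lemma integers_inv_loc (M : int) (p : nat) (a : F) :
    prime p -> ~~ (p%:Z %| M)%Z -> p%:R \in (P : {pred OF}) ->
  a \in integers_inv M -> a \in loc_integers.
Proof.
move=> p_pr pM pP /asboolP[k kaO].
have MP : (M%:~R : OF) \notin (P : {pred OF}).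
  apply/negP => MP.
  have /eqP gcd1 : coprimez p%:Z M.
    by rewrite coprimezE /= prime_coprime.
  have [u [v uv]] : exists u v : int, u * p%:Z + v * M = 1.
    have [u [v uv]] := Bezoutz p%:Z M.
    by exists u, v; rewrite uv gcd1.
  have : (1 : OF) \in (P : {pred OF}).
    rewrite -(rmorph1 (intr : int -> OF)) -uv rmorphD !rmorphM /=.
    by rewrite rpredD // idealMr.
  by rewrite idealr1.
have M0 : (M%:~R : F) != 0.
  apply: contraNneq MP => M0; rewrite (_ : M%:~R = 0) ?rpred0 //.
  by apply: val_inj; rewrite rmorph_int rmorph0.
apply/asboolP; exists (MkOF kaO), (M%:~R ^+ k); split.
  elim: k {kaO} => [|k IH]; first by rewrite expr0 idealr1.
  by rewrite exprS prime_idealrM negb_or MP.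
by rewrite rmorphXn rmorph_int mulrC mulKf // expf_neq0.
Qed.

End Localization.

End NumberField.

Section PadicCompletion.

Variables (p : nat) (A : comNzRingType).

Definition pdvd (k : nat) (a : A) : Prop := exists b, a = p%:R ^+ k * b.

Definition padic_separated : Prop :=
  forall a : A, (forall k, pdvd k a) -> a = 0.

(* enough for completeness: any Cauchy sequence has a subsequence u such that
   u_(k+1) = u_k modulo p^k *)
Definition padic_complete : Prop :=
  forall u : nat -> A, (forall k, pdvd k (u k.+1 - u k)) ->
    exists l, forall k, pdvd k (l - u k).

End PadicCompletion.

(* B is lim_k A / p^k A: it is p-adically separated and complete, and f induces
   isomorphisms A / p^k A -> B / p^k B.  This determines (B, f) up to a unique
   isomorphism. *)
Definition is_padic_completion (p : nat) (A B : comNzRingType)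
    (f : {rmorphism A -> B}) : Prop :=
  [/\ padic_separated p B, padic_complete p B,
      forall k (a : A), pdvd p k (f a) -> pdvd p k a
    & forall k (b : B), exists a, pdvd p k (b - f a)].

Record padicCompletion (p : nat) (A : comNzRingType) := PadicCompletion {
  pc_ring :> comUnitRingType;
  pc_map : {rmorphism A -> pc_ring};
  pc_axiom : is_padic_completion p pc_map
}.

Definition is_localization (A B : comNzRingType) (S : set A)
    (f : {rmorphism A -> B}) : Prop :=
  [/\ forall s, S s -> exists b, f s * b = 1,
      forall b, exists a s, S s /\ b * f s = f a
    & forall a, f a = 0 -> exists2 s, S s & s * a = 0].

Section FormalGL.

Variables (p N : nat) (R : comNzRingType).

Definition mpoly_mx : 'M[{mpoly R[N * N]}]_N :=
  \matrix_(j, k) 'X_(mxvec_index j k).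

(* gl_ring is R[x, 1/det x], with x an N x N matrix of indeterminates, and glhat
   is its p-adic completion *)
Record padicGL := PadicGL {
  gl_ring : comNzRingType;
  gl_loc : {rmorphism {mpoly R[N * N]} -> gl_ring};
  gl_axiom : is_localization [set s | exists k, s = \det mpoly_mx ^+ k] gl_loc;
  glhat :> padicCompletion p gl_ring
}.

Variable G : padicGL.

Definition gl_cst (r : R) : G := pc_map G (gl_loc G (mpolyC _ r)).

Definition gl_x : 'M[G]_N :=
  map_mx (fun f => pc_map G (gl_loc G f)) mpoly_mx.

End FormalGL.

Arguments gl_cst {p N R} G r.
Arguments gl_x {p N R} G.

(* entrywise power a^(k) *)
Definition mxpow (A : comNzRingType) (m n k : nat) (a : 'M[A]_(m, n)) :
  'M[A]_(m, n) := map_mx (fun u => u ^+ k) a.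

(* z / p; meaningful when A is p-torsion free and z is divisible by p *)
Definition divp (p : nat) (A : comNzRingType) (z : A) : A :=
  xget 0 [set y | p%:R * y = z].

Arguments divp p {A} z.

Lemma divpK (p : nat) (A : comNzRingType) (y : A) :
  injective (fun a : A => p%:R * a) -> divp p (p%:R * y) = y.
Proof.
by move=> injp; apply: xget_unique => // z /injp.
Qed.

Definition ideal_gen (A : comNzRingType) (s : seq A) (a : A) : Prop :=
  exists c : nat -> A, a = \sum_(i < size s) c i * s`_i.

Section Derivation.

Variables (p : nat) (A : comNzRingType).

Definition frobenius_lift (f : A -> A) : Prop :=
  forall a, exists b, f a = a ^+ p + p%:R * b.

(* (a^p + b^p - (a + b)^p) / p, as an integral polynomial in a and b *)
Definition Cp (a b : A) : A :=
  - \sum_(1 <= k < p) ('C(p, k) %/ p)%:R * a ^+ k * b ^+ (p - k).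

Definition p_derivation (d : A -> A) : Prop :=
  [/\ d 1 = 0,
      forall a b, d (a + b) = d a + d b + Cp a b
    & forall a b, d (a * b) = a ^+ p * d b + b ^+ p * d a + p%:R * d a * d b].

Definition frob (d : A -> A) (a : A) : A := a ^+ p + p%:R * d a.

End Derivation.

Section Metric.

Variables (p N : nat) (R : comUnitRingType) (G : padicGL p N R).
Variables (dR : R -> R) (Q : 'M[R]_N).

Definition glQ : 'M[G]_N := map_mx (gl_cst G) Q.

(* continuity is automatic for the p-adic topology *)
Definition is_Hq (H : {rmorphism G -> G}) : Prop :=
  (forall r, H (gl_cst G r) = gl_cst G r) /\
  map_mx H (gl_x G) = (gl_x G)^T *m glQ *m gl_x G.

Definition is_phi0 (f : {rmorphism G -> G}) : Prop :=
  [/\ frobenius_lift p f,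
      forall r, f (gl_cst G r) = gl_cst G (frob p dR r)
    & map_mx f (gl_x G) = mxpow p (gl_x G)].

Definition metric_at (d : G -> G) : Prop :=
  exists (H phi0 : {rmorphism G -> G}),
    [/\ is_Hq H, is_phi0 phi0 & frob p d \o H =1 H \o phi0].

Definition gamma (d : G -> G) : 'M[G]_N :=
  (map_mx d (gl_x G))^T *m map_mx (frob p d) glQ *m mxpow p (gl_x G).

End Metric.

Section Vertical.

Variables (p n : nat) (R : 'I_n.+1 -> comUnitRingType).
Variable G : forall i, padicGL p n.+1 (R i).

(* the isomorphisms sigma_i and their inverses *)
Variables (sG : forall i, G ord0 -> G i) (sGV : forall i, G i -> G ord0).
Variables (dR : forall i, R i -> R i) (Q : forall i, 'M[R i]_n.+1).
Variable delta : forall i, G i -> G i.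

Definition vertical_connection : Prop :=
  forall i, p_derivation p (@delta i) /\
            forall r, delta (gl_cst (G i) r) = gl_cst (G i) (dR r).

Definition metric : Prop := forall i, metric_at (@dR i) (Q i) (@delta i).

Definition torsion_free : Prop :=
  forall i j k, sGV (gamma (Q i) (@delta i) j k)
              = sGV (gamma (Q j) (@delta j) i k).

Definition Levi_Civita : Prop :=
  [/\ vertical_connection, metric & torsion_free].

(* sigma_i^-1 phi^i sigma_i *)
Definition phi_conj (i : 'I_n.+1) (a : G ord0) : G ord0 :=
  sGV (frob p (@delta i) (sG i a)).

Definition curvature (i j : 'I_n.+1) (a : G ord0) : G ord0 :=
  divp p (phi_conj i (phi_conj j a) - phi_conj j (phi_conj i a)).

Let x := gl_x (G ord0).
Let q := glQ (G ord0) (Q ord0).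

Definition curvature_mx (i j : 'I_n.+1) : 'M[G ord0]_n.+1 :=
  map_mx (curvature i j) x.

Definition Riemann (i j m k : 'I_n.+1) : G ord0 :=
  ((mxpow (p ^ 2) x)^T *m mxpow (p ^ 2) q *m curvature_mx i j) m k.

Definition Cmx : 'M[G ord0]_n.+1 :=
  - ((mxpow p x)^T *m map_mx (@delta ord0) q *m mxpow p x)
  + map_mx (divp p)
      (mxpow p (x^T *m q *m x) - (mxpow p x)^T *m mxpow p q *m mxpow p x).

End Vertical.

Section Gauge.

Variable F : splittingFieldType rat.

Definition vertical_gauge (n : nat) (sigma : 'I_n.+1 -> gal_of {:F}) : Prop :=
  (forall i, sigma i \in 'Gal({:F} / 1)%g) /\ sigma ord0 = 1%g.

(* the map from the localization of O_F at P, viewed inside F, to its p-adic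
   completion; [insubd 0] never defaults on O_F[1/M], by [integers_inv_loc] *)
Definition completion_emb (p : nat) (P : prime_idealr (OF F))
    (R : padicCompletion p (locOF P)) (a : F) : R := pc_map R (insubd 0 a).

End Gauge.

Arguments completion_emb {F p P} R a.

(* Main.v *)
(** Write [phi_i] for the Frobenius lift on [O(G^1)] conjugate to [phi^i], and
    [phi_i(x) = x^(p) + p D_i].  The ring [O_F / p] is reduced, as the discriminant
    is prime to [p], hence perfect, so that Frobenius lifts are unique on the [R_i]
    and [phi_i(q) = q^(p) + p (delta q)] does not depend on [i].  With
    [Gam_i = D_i^t phi(q) x^(p)] the metric condition, divided by [p], becomes
    [Gam_i + Gam_i^t = C] mod [p], and the vanishing of the torsion says that
    [Gam_i j k] is symmetric in [i] and [j]: as for the classical Christoffel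
    symbols, [2 Gam_j k m = C k m + C j m - C j k].  On the other hand
    [phi_i (phi_j x) = x^(p^2) + p D_j^(p)] mod [p^2], so the curvature matrix is
    [D_j^(p) - D_i^(p)] mod [p] and [R i j m k = (Gam_j k m - Gam_i k m)^p] mod [p].
    Modulo [x - 1], all terms but one of [(x^t q x)_jk] vanish, so the quotient by
    [p] in [C] vanishes and [C = - delta q]. *)

Require Import Defs.
From HB Require Import structures.
From mathcomp Require Import all_boot all_order all_fingroup all_algebra.
From mathcomp Require Import all_solvable all_field.
From mathcomp Require Import mpoly.
From mathcomp Require Import ring zify.
From mathcomp Require Import boolp classical_sets.

Set Implicit Arguments.
Unset Strict Implicit.
Unset Printing Implicit Defensive.

Import GRing.Theory.
Local Open Scope ring_scope.

(** * Congruences modulo an ideal *)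

Section Ideals.

Variables (p : nat) (A : comNzRingType).

Definition is_ideal (J : A -> Prop) : Prop :=
  [/\ J 0, forall a b, J a -> J b -> J (a + b)
    & forall a b, J b -> J (a * b)].

Variable J : A -> Prop.
Hypothesis idJ : is_ideal J.

Lemma idealD (a b : A) : J a -> J b -> J (a + b).
Proof. by case: idJ => _ h _; apply: h. Qed.

Lemma ideal_mull (a b : A) : J b -> J (a * b).
Proof. by case: idJ => _ _; apply. Qed.

Lemma ideal_mulr (a b : A) : J a -> J (a * b).
Proof. by rewrite mulrC; apply: ideal_mull. Qed.

Lemma idealN (a : A) : J a -> J (- a).
Proof. by rewrite -mulN1r; apply: ideal_mull. Qed.

Lemma ideal_sum (I : Type) (r : seq I) (P : pred I) (f : I -> A) :
  (forall i, P i -> J (f i)) -> J (\sum_(i <- r | P i) f i).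
Proof.
by move=> h; apply: (big_ind J) => //; [case: idJ | apply: idealD].
Qed.

Definition cong (a b : A) : Prop := J (a - b).

Lemma cong_refl (a : A) : cong a a.
Proof. by rewrite /cong subrr; case: idJ. Qed.

Lemma cong_sym (a b : A) : cong a b -> cong b a.
Proof. by move/idealN; rewrite opprB. Qed.

Lemma cong_trans (b a c : A) : cong a b -> cong b c -> cong a c.
Proof. by move=> h1 h2; have := idealD h1 h2; rewrite addrA subrK. Qed.

Lemma congD (a b c d : A) : cong a b -> cong c d -> cong (a + c) (b + d).
Proof. by move=> h1 h2; have := idealD h1 h2; rewrite /cong opprD addrACA. Qed.

Lemma congN (a b : A) : cong a b -> cong (- a) (- b).
Proof. by move/idealN; rewrite /cong opprB opprK addrC. Qed.

Lemma congB (a b c d : A) : cong a b -> cong c d -> cong (a - c) (b - d).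
Proof. by move=> h1 h2; apply/congD/congN. Qed.

Lemma congM (a b c d : A) : cong a b -> cong c d -> cong (a * c) (b * d).
Proof.
move=> h1 h2; rewrite /cong (_ : _ - _ = (a - b) * c + b * (c - d)); last by ring.
by apply: idealD; [apply: ideal_mulr | apply: ideal_mull].
Qed.

Lemma congX (a b : A) (k : nat) : cong a b -> cong (a ^+ k) (b ^+ k).
Proof.
move=> h; elim: k => [|k IH]; first exact: cong_refl.
by rewrite !exprS; apply: congM.
Qed.

Lemma cong_sum (I : Type) (r : seq I) (P : pred I) (f g : I -> A) :
  (forall i, P i -> cong (f i) (g i)) ->
  cong (\sum_(i <- r | P i) f i) (\sum_(i <- r | P i) g i).
Proof. by move=> h; rewrite /cong -sumrB; apply: ideal_sum. Qed.

Lemma cong_mulmx (m n r : nat) (a a' : 'M[A]_(m, n)) (b b' : 'M[A]_(n, r)) :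
    (forall i j, cong (a i j) (a' i j)) -> (forall i j, cong (b i j) (b' i j)) ->
  forall i j, cong ((a *m b) i j) ((a' *m b') i j).
Proof. by move=> ha hb i j; rewrite !mxE; apply: cong_sum => k _; apply: congM. Qed.

End Ideals.

(** * The p-th power of a sum, up to multiples of p *)

Section PrimePower.

Variables (p : nat) (p_prime : prime p) (A : comNzRingType).

(** The binomials ['C(p, k)] with 0 < k < p are divisible by p and their monomials contain both a
    and b. The factor [a * b] is kept explicit so that the error can be located in an ideal. *)
Lemma exprD_prime (a b : A) :
  exists w, (a + b) ^+ p = a ^+ p + b ^+ p + p%:R * (a * b * w).
Proof.
have [k pk] : exists k, p = k.+2 by case: p p_prime => [|[|k]] //; exists k.
exists (\sum_(i < k.+1) ('C(p, i.+1) %/ p)%:R * (a ^+ (k - i) * b ^+ i)).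
rewrite exprDn pk big_ord_recr big_ord_recl /= subn0 subnn !expr0 bin0 binn.
rewrite !mulr1 !mul1r !mulr1n -!addrA; congr (_ + _); rewrite addrC; congr (_ + _).
rewrite 2!mulr_sumr; apply: eq_bigr => i _.
rewrite /bump /= add1n -pk -mulr_natl.
have ki : (i <= k)%N by rewrite -ltnS.
have -> : (p - i.+1 = (k - i).+1)%N by rewrite pk subSS subSn.
have /divnK {1}<- : (p %| 'C(p, i.+1))%N by rewrite prime_dvd_bin // pk /= !ltnS ki.
by rewrite natrM !exprS; ring.
Qed.

(** Finer than a congruence modulo p: each correction is p times a combination of products of
    distinct terms, so the cofactor of p itself lies in J. This controls the quotient by p that
    occurs in C. *)
Lemma exprD_sum_prime (J : A -> Prop) (I : eqType) (r : seq I) (t : I -> A) :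
    is_ideal J -> uniq r ->
    {in r &, forall i j, i != j -> J (t i * t j)} ->
  exists2 w, J w & (\sum_(i <- r) t i) ^+ p = \sum_(i <- r) t i ^+ p + p%:R * w.
Proof.
move=> idJ; elim: r => [_ _|i r IH /= /andP[ir ur] h].
  exists 0; first by case: idJ.
  by rewrite !big_nil mulr0 addr0 expr0n (negPf (lt0n_neq0 (prime_gt0 p_prime))).
have [j k jr kr|w Jw e] := IH ur; first by apply: h; rewrite inE ?jr ?kr orbT.
have [v ev] := exprD_prime (t i) (\sum_(j <- r) t j).
exists (t i * (\sum_(j <- r) t j) * v + w).
  apply: idealD => //; apply: ideal_mulr => //; rewrite mulr_sumr.
  rewrite big_seq_cond; apply: ideal_sum => // j /andP[jr _].
  apply: h; rewrite ?inE ?eqxx ?jr ?orbT //.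
  by apply: contraNneq ir => ->.
by rewrite !big_cons ev e; ring.
Qed.

Lemma cong_exprD (J : A -> Prop) (a b : A) : is_ideal J -> J p%:R ->
  cong J ((a + b) ^+ p) (a ^+ p + b ^+ p).
Proof.
move=> idJ Jp; have [w ->] := exprD_prime a b.
by rewrite /cong addrC addKr; apply: ideal_mulr.
Qed.

Lemma cong_exprN (J : A -> Prop) (a : A) : is_ideal J -> J p%:R ->
  cong J ((- a) ^+ p) (- a ^+ p).
Proof.
move=> idJ Jp; have := cong_exprD a (- a) idJ Jp.
rewrite /cong subrr expr0n (negPf (lt0n_neq0 (prime_gt0 p_prime))) sub0r.
by move/(idealN idJ); rewrite !opprK addrC.
Qed.

Lemma cong_exprB (J : A -> Prop) (a b : A) : is_ideal J -> J p%:R ->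
  cong J ((a - b) ^+ p) (a ^+ p - b ^+ p).
Proof.
move=> idJ Jp; apply: cong_trans (cong_exprD _ _ idJ Jp) _ => //.
by apply: congD => //; [apply: cong_refl | apply: cong_exprN].
Qed.

Lemma cong_expr_sum (J : A -> Prop) (I : Type) (r : seq I) (P : pred I) (t : I -> A) :
  is_ideal J -> J p%:R ->
  cong J ((\sum_(i <- r | P i) t i) ^+ p) (\sum_(i <- r | P i) t i ^+ p).
Proof.
move=> idJ Jp; apply: (big_ind2 (fun a b => cong J (a ^+ p) b)) => [|a b c d h1 h2|i _].
- by rewrite expr0n (negPf (lt0n_neq0 (prime_gt0 p_prime))); apply: cong_refl.
- by apply: cong_trans (cong_exprD _ _ idJ Jp) _ => //; apply: congD.
- exact: cong_refl.
Qed.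

Lemma expr2_prime : exists k, (2 ^ p = 2 + p * k)%N.
Proof.
have : (2 ^ p = 2 %[mod p])%N by rewrite fermat_little.
have le2 : (2 <= 2 ^ p)%N by rewrite -{1}(expn1 2) leq_exp2l // prime_gt0.
move/eqP; rewrite eqn_mod_dvd // => /dvdnP[k e].
by exists k; rewrite mulnC -e subnKC.
Qed.

End PrimePower.

(** * Divisibility by powers of p and finitely generated ideals *)

Section PadicDivisibility.

Variables (p : nat) (A : comNzRingType).

Lemma is_ideal_pdvd (k : nat) : is_ideal (@pdvd p A k).
Proof.
split; first by exists 0; rewrite mulr0.
  by move=> _ _ [a ->] [b ->]; exists (a + b); rewrite mulrDr.
by move=> a _ [b ->]; exists (a * b); rewrite mulrCA.
Qed.

Lemma pdvd1_p : @pdvd p A 1 p%:R.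
Proof. by exists 1; rewrite expr1 mulr1. Qed.

Lemma ideal_gen1 (a : A) : ideal_gen [:: p%:R] a <-> pdvd p 1 a.
Proof.
split=> [[c ->]|[b ->]]; first by exists (c 0%N); rewrite big_ord1 expr1 mulrC.
by exists (fun=> b); rewrite big_ord1 expr1 mulrC.
Qed.

Lemma is_ideal_gen (s : seq A) : is_ideal (ideal_gen s).
Proof.
split; first by exists (fun=> 0); rewrite big1 // => i _; rewrite mul0r.
  move=> _ _ [c ->] [d ->]; exists (fun i => c i + d i).
  by rewrite -big_split; apply: eq_bigr => i _; rewrite mulrDl.
move=> a _ [c ->]; exists (fun i => a * c i).
by rewrite mulr_sumr; apply: eq_bigr => i _; rewrite mulrA.
Qed.

Lemma mem_ideal_gen (s : seq A) (a : A) : a \in s -> ideal_gen s a.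
Proof.
move=> a_s; have lt : (index a s < size s)%N by rewrite index_mem.
exists (fun i => (i == index a s)%:R).
rewrite (bigD1 (Ordinal lt)) //= eqxx mul1r nth_index // big1 ?addr0 // => i.
by rewrite -val_eqE /= => /negPf ->; rewrite mul0r.
Qed.

Lemma pdvd1_ideal (J : A -> Prop) (a : A) :
  is_ideal J -> J p%:R -> pdvd p 1 a -> J a.
Proof. by move=> idJ Jp [b ->]; rewrite expr1; apply: ideal_mulr. Qed.

End PadicDivisibility.

(** * From p-derivations to Frobenius lifts as ring morphisms *)

Section FrobeniusLift.

Variables (p : nat) (p_prime : prime p) (A : comNzRingType).

Lemma mulr_Cp (a b : A) : p%:R * Cp p a b = a ^+ p + b ^+ p - (a + b) ^+ p.
Proof.
have [k pk] : exists k, p = k.+2 by case: p p_prime => [|[|k]] //; exists k.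
rewrite [a + b]addrC exprDn -(big_mkord predT (fun i => (b ^+ (p - i) * a ^+ i) *+ 'C(p, i))).
rewrite big_nat_recr //= big_ltn ?prime_gt0 // subn0 subnn !expr0 bin0 binn.
rewrite !mulr1 !mul1r !mulr1n /Cp mulrN mulr_sumr.
have -> : \sum_(1 <= i < p) p%:R * (('C(p, i) %/ p)%:R * a ^+ i * b ^+ (p - i)) =
    \sum_(1 <= i < p) (b ^+ (p - i) * a ^+ i) *+ 'C(p, i).
  apply: eq_big_nat => i ip; rewrite -[RHS]mulr_natl.
  have /divnK {2}<- : (p %| 'C(p, i))%N by rewrite prime_dvd_bin.
  by rewrite natrM; ring.
by ring.
Qed.

(** The term p [Cp] compensates the defect of additivity of the p-th power. The sigma type allows
    the morphism to be extracted later as a function of the index i. *)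
Lemma frob_rmorphism (d : A -> A) : p_derivation p d ->
  {f : {rmorphism A -> A} | f =1 frob p d}.
Proof.
case=> d1 dD dM; pose f := frob p d.
have fD a b : f (a + b) = f a + f b.
  by rewrite /f /frob dD mulrDr mulr_Cp; ring.
have f0 : f 0 = 0 by apply: (addrI (f 0)); rewrite -fD !addr0.
have fB : zmod_morphism f.
  move=> a b; apply: (addIr (f b)); rewrite -fD !subrK.
  by [].
have fM : monoid_morphism f.
  split; first by rewrite /f /frob d1 expr1n mulr0 addr0.
  by move=> a b; rewrite /f /frob dM exprMn; ring.
pose fA := GRing.isZmodMorphism.Build _ _ f fB.
pose fR := GRing.isMonoidMorphism.Build _ _ f fM.
pose g : {rmorphism A -> A} := HB.pack f fA fR.
by exists g.
Qed.

Lemma rmorphism_inv (B : comNzRingType) (s : {rmorphism A -> B}) (t : B -> A) :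
  cancel s t -> cancel t s -> {f : {rmorphism B -> A} | f =1 t}.
Proof.
move=> st ts; have s_inj := can_inj st.
have tB : zmod_morphism t by move=> a b; apply: s_inj; rewrite rmorphB !ts.
have tM : monoid_morphism t.
  by split=> [|a b]; apply: s_inj; rewrite ?rmorph1 ?rmorphM !ts.
pose tA := GRing.isZmodMorphism.Build _ _ t tB.
pose tR := GRing.isMonoidMorphism.Build _ _ t tM.
pose g : {rmorphism B -> A} := HB.pack t tA tR.
by exists g.
Qed.

End FrobeniusLift.

(** * Entrywise powers of matrices *)

Section MatrixPower.

Variables (p : nat) (A : comNzRingType).

Lemma mxpow_trmx (m n k : nat) (a : 'M[A]_(m, n)) : mxpow k a^T = (mxpow k a)^T.
Proof. by rewrite /mxpow map_trmx. Qed.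

Lemma mxpowM (m n k l : nat) (a : 'M[A]_(m, n)) :
  mxpow l (mxpow k a) = mxpow (k * l) a.
Proof. by apply/matrixP => i j; rewrite !mxE exprM. Qed.

Lemma cong_mxpow_mul (p_prime : prime p) (J : A -> Prop) (m n r : nat)
    (a : 'M[A]_(m, n)) (b : 'M[A]_(n, r)) (i : 'I_m) (j : 'I_r) :
  is_ideal J -> J p%:R -> cong J (((a *m b) i j) ^+ p) ((mxpow p a *m mxpow p b) i j).
Proof.
move=> idJ Jp; rewrite !mxE; apply: cong_trans (cong_expr_sum _ _ _ _ idJ Jp) _ => //.
by apply: cong_sum => // k _; rewrite !mxE exprMn; apply: cong_refl.
Qed.

End MatrixPower.

(** * Christoffel symbols and curvature modulo p, all Frobenius lifts being carried to one ring *)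

Section LeviCivitaCongruences.

Variables (p : nat) (p_prime : prime p) (A : comUnitRingType).
Variables (unit2 : (2%:R : A) \is a GRing.unit).
Hypothesis injp : injective (fun a : A => p%:R * a).
Variables (n : nat) (x q dq : 'M[A]_n).
Hypothesis q_sym : q^T = q.
Variables (phi : 'I_n -> {rmorphism A -> A}) (D : 'I_n -> 'M[A]_n).

Let X := mxpow p x.
Let q1 := mxpow p q + p%:R *: dq.
Let Gam i := (D i)^T *m q1 *m X.

Hypothesis phi_frob : forall i, frobenius_lift p (phi i).
Hypothesis phi_x : forall i, map_mx (phi i) x = X + p%:R *: D i.
Hypothesis phi_q : forall i, map_mx (phi i) q = q1.
Hypothesis phi_metric : forall i, map_mx (phi i) (x^T *m q *m x) = mxpow p (x^T *m q *m x).
Hypothesis torsionless : forall i j k, Gam i j k = Gam j i k.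

Let J := @pdvd p A 1.
Let idJ : is_ideal J := @is_ideal_pdvd p A 1.
Let Jp : J p%:R := @pdvd1_p p A.

Let C := - (X^T *m dq *m X)
  + map_mx (Defs.divp p) (mxpow p (x^T *m q *m x) - X^T *m mxpow p q *m X).

Let q1_sym (i : 'I_n) : q1^T = q1.
Proof. by rewrite -(phi_q i) map_trmx q_sym. Qed.

(** Expand phi_i (x^t q x) = (X + p D_i)^t q1 (X + p D_i) and cancel p. The term with [dq] in C
    removes the contribution of the p [dq] contained in [q1]. *)
Lemma metric_Cmx (i : 'I_n) : C = Gam i + (Gam i)^T + p%:R *: ((D i)^T *m q1 *m D i).
Proof.
have e : mxpow p (x^T *m q *m x) - X^T *m mxpow p q *m X =
    p%:R *: (X^T *m dq *m X + (Gam i + (Gam i)^T + p%:R *: ((D i)^T *m q1 *m D i))).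
  have eX : X^T *m q1 *m X = X^T *m mxpow p q *m X + p%:R *: (X^T *m dq *m X).
    by rewrite /q1 mulmxDr mulmxDl -scalemxAr -scalemxAl.
  have eG : (Gam i)^T = X^T *m q1 *m D i.
    by rewrite /Gam !trmx_mul trmxK (q1_sym i) mulmxA.
  have eT : (X + p%:R *: D i)^T = X^T + p%:R *: (D i)^T by rewrite linearD linearZ.
  rewrite -(phi_metric i) !map_mxM -map_trmx phi_x phi_q eG eT.
  move: eX; rewrite /Gam; move: q1 => Q1 eX.
  rewrite !mulmxDl !mulmxDr -!scalemxAl -!scalemxAr eX.
  move: (_ *m X) (_ *m X) (_ *m X) (_ *m D i) (_ *m D i) => m1 m2 m3 m4 m5.
  by apply/matrixP => j k; rewrite !mxE; ring.
rewrite /C e; apply/matrixP => j k; rewrite !mxE Defs.divpK //.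
by rewrite addKr.
Qed.

Let cong_C (i j k : 'I_n) : cong J (C j k) (Gam i j k + Gam i k j).
Proof.
rewrite /cong (metric_Cmx i) mxE [X in _ + X - _]mxE.
have -> : (Gam i + (Gam i)^T) j k = Gam i j k + Gam i k j.
  by rewrite mxE [_^T j k]mxE.
rewrite addrC addKr.
by apply: ideal_mulr.
Qed.

(* the Koszul formula for Christoffel symbols *)
Let koszul (j k m : 'I_n) : cong J (C k m + C j m - C j k) (2%:R * Gam j k m).
Proof.
suff -> : 2%:R * Gam j k m =
    (Gam j k m + Gam j m k) + (Gam k j m + Gam k m j) - (Gam m j k + Gam m k j).
  by apply: congB => //; apply: congD.
by rewrite (torsionless k j) (torsionless m j) (torsionless m k); ring.
Qed.

(** In the p-th power of a^p + p b, the last term is divisible by p^p and the cross terms gain a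
    second factor p. Precision p^2 is required because the curvature is divided by p. *)
Lemma frobenius_lift_X (i : 'I_n) (a : A) :
  exists b, phi i (a ^+ p) = a ^+ (p * p) + p%:R ^+ 2 * b.
Proof.
have [b e] := phi_frob i a; rewrite rmorphXn e.
have [w ->] := exprD_prime p_prime (a ^+ p) (p%:R * b).
have [k pk] : exists k, p = k.+2 by case: p p_prime => [|[|k]] //; exists k.
exists (p%:R ^+ k * b ^+ p + a ^+ p * b * w).
rewrite -exprM exprMn (_ : p%:R ^+ p = p%:R ^+ 2 * p%:R ^+ k); last first.
  by rewrite -exprD {2}pk.
by move: (_ ^+ k) (b ^+ p) (a ^+ p) (a ^+ (p * p)) => c1 c2 c3 c4; ring.
Qed.

(** In phi_a (phi_b x) = phi_a X + p phi_a D_b, the first term is x^(p^2) modulo p^2 whatever a is,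
    so it cancels in the commutator, and phi_a D_b is D_b^(p) modulo p. *)
Lemma curvature_cong (i j : 'I_n) :
  exists2 Phi : 'M[A]_n,
    map_mx (phi i) (map_mx (phi j) x) - map_mx (phi j) (map_mx (phi i) x) = p%:R *: Phi
  & forall k l, cong J (Phi k l) (mxpow p (D j - D i) k l).
Proof.
have h (a b : 'I_n) : exists2 E : 'M[A]_n,
    map_mx (phi a) (map_mx (phi b) x) = mxpow (p * p) x + p%:R *: E
  & forall k l, cong J (E k l) (D b k l ^+ p).
  have /choice[e eP] : forall kl : 'I_n * 'I_n, exists e,
      phi a (x kl.1 kl.2 ^+ p) = x kl.1 kl.2 ^+ (p * p) + p%:R ^+ 2 * e.
    by move=> kl; apply: frobenius_lift_X.
  exists (\matrix_(k, l) (p%:R * e (k, l) + phi a (D b k l))).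
    rewrite phi_x; apply/matrixP => k l; rewrite !mxE rmorphD rmorphM rmorph_nat.
    by rewrite (eP (k, l)) /=; ring.
  move=> k l; rewrite mxE; have [c ->] := phi_frob a (D b k l).
  rewrite /cong addrCA addrAC subrr add0r -mulrDr; exact: ideal_mulr.
have [E1 e1 c1] := h i j; have [E2 e2 c2] := h j i.
exists (E1 - E2); first by rewrite e1 e2 opprD addrACA subrr add0r scalerBr.
move=> k l; rewrite !mxE; apply: cong_trans (congB idJ (c1 k l) (c2 k l)) _ => //.
by apply: cong_sym => //; apply: cong_exprB.
Qed.

(** Since 2^p = 2 modulo p by Fermat, the p-th power leaves the coefficient 1/2 instead of turning
    it into 1/2^p. *)
Lemma half_expr_prime (a b : A) : cong J (2%:R * a) b ->
  cong J (a ^+ p) (2%:R^-1 * b ^+ p).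
Proof.
move=> h; have /(congX idJ p) := h; rewrite exprMn -natrX.
have [k ->] := expr2_prime p_prime; rewrite natrD natrM => h2.
have h3 : cong J (2%:R * a ^+ p) (b ^+ p).
  apply: cong_trans h2 => //; apply: cong_sym => //.
  by rewrite /cong mulrDl addrAC subrr add0r -mulrA; apply: ideal_mulr.
by have := congM idJ (cong_refl idJ 2%:R^-1) h3; rewrite mulKr.
Qed.

Lemma Riemann_cong (i j m k : 'I_n) (Phi : 'M[A]_n) :
    (forall k l, cong J (Phi k l) (mxpow p (D j - D i) k l)) ->
  cong J (((mxpow (p * p) x)^T *m mxpow (p * p) q *m Phi) m k)
    (2%:R^-1 * (C i k + C j m - C j k - C i m) ^+ p).
Proof.
move=> hPhi.
apply: (@cong_trans _ _ idJ ((Gam j k m - Gam i k m) ^+ p)); last first.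
  apply: half_expr_prime; rewrite mulrBr.
  have := congB idJ (koszul j k m) (koszul i k m) => /(cong_sym idJ).
  by congr (cong J _ _); ring.
(* By symmetry of [q1], the transpose of [Gam l] is [X^T *m q1 *m D l], which is linear in [D l]. *)
have -> : Gam j k m - Gam i k m = (X^T *m q1 *m (D j - D i)) m k.
  rewrite mulmxBr.
  have e l : X^T *m q1 *m D l = (Gam l)^T.
    by rewrite /Gam !trmx_mul trmxK (q1_sym i) mulmxA.
  by rewrite !e !mxE.
(* Additivity of the p-th power modulo p distributes it over the matrix products; it turns X into
   x^(p^2) and [q1] into q^(p^2) modulo p. *)
apply: cong_sym => //; apply: cong_trans (cong_mxpow_mul p_prime _ _ _ _ idJ Jp) _ => //.
apply: cong_mulmx => // [a b|a b]; last exact: cong_sym.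
rewrite [X in cong _ X]mxE; apply: cong_trans (cong_mxpow_mul p_prime _ _ _ _ idJ Jp) _ => //.
apply: cong_mulmx => // [c d|c d].
  by rewrite /X mxpow_trmx mxpowM; apply: cong_refl.
rewrite -mxpowM ![mxpow p _ _ _]mxE; apply: congX => //.
by rewrite /cong !mxE addrAC subrr add0r; apply: ideal_mulr.
Qed.

Lemma Cmx_cong (I : A -> Prop) (j k : 'I_n) : is_ideal I -> I p%:R ->
    (forall a b, I ((x - 1%:M) a b)) -> cong I (C j k) (- dq j k).
Proof.
move=> idI Ip Ix.
have x1 a b : cong I (x a b) (a == b)%:R.
  by have := Ix a b; rewrite !mxE.
have X1 a b : cong I (X a b) ((1%:M : 'M[A]_n) a b).
  rewrite !mxE; apply: cong_trans (congX idI p (x1 a b)) _ => //.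
  rewrite -natrX; case: (a == b); first by rewrite exp1n; apply: cong_refl.
  by rewrite exp0n ?prime_gt0 //; apply: cong_refl.
rewrite /C; apply: (@cong_trans _ _ idI (- dq j k + 0)); last first.
  by rewrite addr0; apply: cong_refl.
rewrite mxE; apply: congD => //.
  rewrite mxE; apply: congN => //.
  have -> : dq = (1%:M)^T *m dq *m 1%:M by rewrite trmx1 mul1mx mulmx1.
  apply: cong_mulmx => // a b; apply: cong_mulmx => // c d.
    by rewrite trmx1; have := X1 d c; rewrite !mxE eq_sym.
  by rewrite trmx1 mul1mx mulmx1; apply: cong_refl.
(* These are the terms of the (j, k) entry of x^t q x; only the one of index (j, k) may lie outside
   I. *)
pose t (ab : 'I_n * 'I_n) := x ab.1 j * q ab.1 ab.2 * x ab.2 k.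
have tI ab : ab != (j, k) -> I (t ab).
  case: ab => a b; rewrite xpair_eqE negb_and /t /= => /orP[] /negPf nab.
    by do 2 apply: ideal_mulr => //; have := x1 a j; rewrite nab /cong subr0.
  by apply: ideal_mull => //; have := x1 b k; rewrite nab /cong subr0.
(* Of two distinct terms at least one lies in I, so the cofactor w of p is in I; this w is the
   quotient by p in C. *)
have [|w Iw ew] := exprD_sum_prime (t := t) p_prime idI
    (index_enum_uniq ('I_n * 'I_n)%type).
  move=> u v _ _ uv; case: (eqVneq u (j, k)) => [uE|/tI h]; last exact: ideal_mulr.
  by apply: ideal_mull => //; apply: tI; rewrite -uE eq_sym.
suff -> : map_mx (Defs.divp p) (mxpow p (x^T *m q *m x) - X^T *m mxpow p q *m X) j k = w.
  by rewrite /cong subr0.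
have mulE (y z : 'M[A]_n) :
    (y^T *m z *m y) j k = \sum_(ab : 'I_n * 'I_n) y ab.1 j * z ab.1 ab.2 * y ab.2 k.
  rewrite mxE; transitivity (\sum_b \sum_a y a j * z a b * y b k).
    apply: eq_bigr => b _; rewrite mxE mulr_suml.
    by apply: eq_bigr => a _; rewrite mxE.
  by rewrite exchange_big pair_bigA.
rewrite mxE (_ : _ j k = p%:R * w) ?Defs.divpK // mxE [X in _ + X]mxE mulE.
rewrite mxE mulE ew addrC.
rewrite (eq_bigr (fun ab => t ab ^+ p)) ?addKr // => ab _.
by rewrite !mxE !exprMn.
Qed.

End LeviCivitaCongruences.

(** * Algebraic integers and their traces *)

Section NumberField.

Variable F : splittingFieldType rat.

Lemma intr_alg (m : int) : (m%:~R : F) = (m%:~R : rat)%:A.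
Proof. by rewrite -[RHS]/(in_alg F _) rmorph_int. Qed.

Lemma intr_inj_alg : injective (intr : int -> F).
Proof. by move=> a b; rewrite !intr_alg => /(fmorph_inj (in_alg F))/intr_inj. Qed.

Lemma natr_alg_eq0 (m : nat) : ((m%:R : F) == 0) = (m == 0%N).
Proof.
apply/eqP/eqP => [|->//]; rewrite -[m%:R]/((m%:Z)%:~R) -[0]/(0%:~R).
by move/intr_inj_alg => -[].
Qed.

Lemma galOF_natM (s : gal_of {:F}) (m : nat) (a : OF F) :
  galOF s (m%:R * a) = m%:R * galOF s a.
Proof.
apply: val_inj; change (s (val (m%:R * a)) = val (m%:R * galOF s a)).
by rewrite !rmorphM !rmorph_nat.
Qed.

Lemma galOF_expr (s : gal_of {:F}) (k : nat) (a : OF F) :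
  galOF s (a ^+ k) = galOF s a ^+ k.
Proof.
apply: val_inj; change (s (val (a ^+ k)) = val (galOF s a ^+ k)).
by rewrite !rmorphXn.
Qed.

(** The monic equation is transported to [algC], where rational algebraic integers are known to be
    integers. *)
Lemma integral_rat (k : rat) : k%:A \in @integers F -> exists m : int, k = m%:~R.
Proof.
case/integersP => r monr /=.
have -> : map_poly (intr : int -> F) r = map_poly (in_alg F) (map_poly intr r).
  by rewrite -map_poly_comp; apply: eq_map_poly => m /=; rewrite intr_alg.
rewrite fmorph_root -(fmorph_root (ratr : rat -> algC)) => rk.
have /Num.Theory.intrP[m km] : (ratr k : algC) \is a Num.int.
  apply: Cint_rat_Aint; first exact: Crat_rat.
  apply: (root_monic_Aint rk); first by rewrite !monic_map.
  rewrite -map_poly_comp; apply: polyOver_poly => i _ /=; rewrite rmorph_int.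
  exact: Num.Theory.intr_int.
exists m; have : ratr k = ratr m%:~R :> algC by rewrite km rmorph_int.
exact: fmorph_inj.
Qed.

(** The trace lies in the base field, and it is integral as a sum of conjugates of a. *)
Lemma trace_integral (galF : galois 1 {:F}) (a : F) : a \in @integers F ->
  exists m : int, galTrace 1 {:F} a = m%:~R.
Proof.
move=> aO; have /vlineP[k ek] := mem_galTrace galF (memvf a).
have [|m km] := @integral_rat k; last by exists m; rewrite ek km intr_alg.
rewrite -ek; apply: rpred_sum => s _.
exact: (gal_integers s (MkOF aO)).
Qed.

(** * The ring O_F / p is reduced and perfect when p does not divide the discriminant *)

Section Unramified.

Variables (galF : galois 1 {:F}) (M disc : int) (Hdisc : is_discriminant F disc).
Variables (p : nat) (p_prime : prime p).
Hypothesis p_disc : ~~ (p%:Z %| disc)%Z.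

Notation d := (\dim {:F}).

Lemma integral_basis_coord (b : d.-tuple F) (c : 'I_d -> int) (i : 'I_d) :
  basis_of {:F} b -> coord b i (\sum_j (c j)%:~R * tnth b j) = (c i)%:~R.
Proof.
move=> bb; rewrite -[RHS](coord_sum_free (fun j => (c j)%:~R) i (basis_free bb)).
congr (coord b i _); apply: eq_bigr => j _.
by rewrite intr_alg mulr_algl (tnth_nth 0).
Qed.

(** The rational number m / p equals a, hence is integral, hence is an integer. *)
Lemma integral_multiple (m : int) (a : OF F) :
  p%:R * a = m%:~R -> (p%:Z %| m)%Z.
Proof.
move=> e; have p0 : (p%:R : rat) != 0 by rewrite Num.Theory.pnatr_eq0 -lt0n prime_gt0.
have eF : (m%:~R / p%:R : rat)%:A = val a.
  have p0F : (p%:R : F) != 0 by rewrite natr_alg_eq0 -lt0n prime_gt0.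
  apply: (mulfI p0F); have := congr1 val e; rewrite rmorphM rmorph_nat rmorph_int => ->.
  rewrite -(rmorph_nat (in_alg F)) -rmorphM /= mulrC divfK //.
  by rewrite -intr_alg.
have [|k ek] := @integral_rat (m%:~R / p%:R); first by rewrite eF (valP a).
apply/dvdzP; exists k; apply: (@intr_inj rat).
by rewrite rmorphM /= -ek -[p%:Z%:~R]/(p%:R) divfK.
Qed.

(* Since tr (a b)^p is congruent to tr ((a b)^p), an element a with p | a^p has
   all the traces tr (a b) divisible by p, so that p divides a as the trace form
   is perfect mod p. *)
Lemma integers_mod_reduced (a : OF F) : pdvd p 1 (a ^+ p) -> pdvd p 1 a.
Proof.
move=> [a' ea].
have [b [bb bO bgen] eD] := Hdisc.
pose J := @pdvd p (OF F) 1.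
have idJ : is_ideal J := is_ideal_pdvd p (OF F) 1.
have Jp : J p%:R := pdvd1_p p (OF F).
have trp (c : OF F) : exists m : int, galTrace 1 {:F} (val (a * c)) = (p%:Z * m)%:~R.
  have [m em] := trace_integral galF (valP (a * c)); rewrite em.
  suff /dvdzP[k ->] : (p%:Z %| m)%Z by exists k; rewrite mulrC.
  suff : (p%:Z %| m ^+ p)%Z by rewrite !dvdzE abszX /= Euclid_dvdX // => /andP[].
  (* The trace is taken inside [OF], where its p-th power is, modulo p, a sum of conjugates of (a
     c)^p, each divisible by p. *)
  pose t : OF F := \sum_(s in 'Gal({:F} / 1)%g) galOF s (a * c).
  have tm : t = m%:~R.
    apply: val_inj; rewrite rmorph_int -em raddf_sum.
    by [].
  have : cong J (t ^+ p) 0.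
    apply: cong_trans (cong_expr_sum p_prime _ _ _ idJ Jp) _ => //.
    rewrite /cong subr0; apply: ideal_sum => // s _.
    rewrite -galOF_expr exprMn ea expr1 -mulrA galOF_natM.
    exact: ideal_mulr.
  rewrite /cong subr0 tm -rmorphXn => -[w /esym]; rewrite expr1.
  exact: integral_multiple.
have [c ec] := bgen (val a) (valP a).
have /choice[T eT] : forall ij : 'I_d * 'I_d, exists m : int,
    galTrace 1 {:F} (tnth b ij.1 * tnth b ij.2) = m%:~R.
  by move=> ij; apply: (trace_integral galF); apply: rpredM; apply: bO.
have /choice[m em] : forall j : 'I_d, exists m : int,
    galTrace 1 {:F} (val a * tnth b j) = (p%:Z * m)%:~R.
  by move=> j; have := trp (MkOF (bO j)).
pose Tz : 'M[int]_d := \matrix_(i, j) T (i, j).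
have disc_Tz : disc = \det Tz.
  apply: intr_inj_alg; rewrite eD -det_map_mx; congr (\det _).
  by apply/matrixP => i j; rewrite !mxE (eT (i, j)).
have cT : (\row_i c i) *m Tz = p%:Z *: (\row_j m j).
  apply/rowP => j; rewrite !mxE; apply: intr_inj_alg.
  rewrite -em ec mulr_suml !raddf_sum; apply: eq_bigr => i _.
  rewrite !mxE /= intrM -(eT (i, j)) /= -mulrA !mulrzl.
  by rewrite raddfMz.
have pc i : exists k, c i = p%:Z * k.
  have : (p%:Z %| disc * c i)%Z.
    (* The adjugate replaces the trace matrix by its determinant [disc], which is prime to p. *)
    have /rowP/(_ i) := congr1 (mulmx^~ (\adj Tz)) cT.
    rewrite -mulmxA mul_mx_adj mul_mx_scalar -scalemxAl -disc_Tz !mxE => ->.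
    exact: dvdz_mulr.
  rewrite Gauss_dvdzr; last by rewrite coprimezE /= prime_coprime // -dvdzE.
  by case/dvdzP => k ->; exists k; rewrite mulrC.
have [k ek] := choice pc.
exists (\sum_i (k i)%:~R * MkOF (bO i)).
apply: val_inj; rewrite ec expr1 rmorphM rmorph_nat raddf_sum mulr_sumr.
apply: eq_bigr => i _; transitivity (p%:R * val ((k i)%:~R * MkOF (bO i))) => //.
by rewrite rmorphM rmorph_int ek intrM mulrA.
Qed.

(** Residues modulo p are represented by the finitely many [L f], with coordinates in [0, p). As O_F
    / p is reduced, Frobenius is injective on this finite set, hence surjective. *)
Lemma integers_frobenius_surj (a : OF F) : exists b, pdvd p 1 (a - b ^+ p).
Proof.
have [b [bb bO bgen] _] := Hdisc.
pose J := @pdvd p (OF F) 1.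
have idJ : is_ideal J := is_ideal_pdvd p (OF F) 1.
have Jp : J p%:R := pdvd1_p p (OF F).
pose L (f : {ffun 'I_d -> 'I_p}) : OF F := \sum_i (f i)%:R * MkOF (bO i).
have p0 := prime_gt0 p_prime.
have red (e : OF F) : exists f, J (e - L f).
  have [c ec] := bgen (val e) (valP e).
  have red1 (z : int) : exists r : 'I_p, exists w : int, z = p%:Z * w + (r : nat)%:Z.
    have pz : p%:Z != 0 by rewrite -lt0n.
    have lt : (`|(z %% p%:Z)%Z| < p)%N.
      by rewrite -ltz_nat gez0_abs ?modz_ge0 // ltz_pmod.
    exists (Ordinal lt), (z %/ p%:Z)%Z => /=.
    by rewrite gez0_abs ?modz_ge0 // mulrC -divz_eq.
  have [r /choice[w rw]] := choice (fun i => red1 (c i)).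
  exists (finfun r), (\sum_i (w i)%:~R * MkOF (bO i)).
  rewrite expr1 /L mulr_sumr; apply/eqP; rewrite subr_eq -big_split; apply/eqP.
  apply: val_inj; rewrite ec raddf_sum; apply: eq_bigr => i _.
  rewrite ffunE -[RHS]/(val (_ + _)) rmorphD !rmorphM rmorph_int !rmorph_nat.
  by rewrite rw intrD intrM mulrA -mulrDl.
have L_inj f g : J (L f - L g) -> f = g.
  case=> e; rewrite expr1 => ee; have [c ec] := bgen (val e) (valP e).
  apply/ffunP => i; apply: val_inj => /=.
  have : (f i)%:R - (g i)%:R = p%:R * (c i)%:~R :> rat.
    have := congr1 (val : OF F -> F) ee; rewrite rmorphB rmorphM rmorph_nat [X in _ * X]ec.
    rewrite -(rmorph_nat (in_alg F)) mulr_algl => /(congr1 (coord b i)).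
    rewrite linearB linearZ.
    have LE (h : {ffun 'I_d -> 'I_p}) : coord b i (val (L h)) = (h i)%:R.
      rewrite -[RHS](integral_basis_coord (fun j => (h j)%:Z) i bb).
      rewrite /L raddf_sum; congr (coord b i _); apply: eq_bigr => j _.
      by rewrite -[LHS]/(val (_ * _)) rmorphM rmorph_nat.
    by rewrite -(LE f) -(LE g) -(integral_basis_coord c i bb).
  move=> efg; have {}efg : (f i)%:Z - (g i)%:Z = p%:Z * c i.
    by apply: (@intr_inj rat); rewrite rmorphB rmorphM.
  have := ltn_ord (f i); have := ltn_ord (g i); move: efg.
  move: (nat_of_ord (f i)) (nat_of_ord (g i)) (c i) => u v w uvw vp up.
  have [w0|[w0|w0]] : w = 0 \/ (1 <= w \/ w <= -1) by lia.
  - by lia.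
  - by nia.
  - by nia.
have /choice[Fr FrP] : forall f, exists g, J (L f ^+ p - L g) by move=> f; apply: red.
have Fr_inj : injective Fr.
  move=> f g efg; apply: L_inj; apply: integers_mod_reduced.
  have h : cong J (L f ^+ p) (L g ^+ p).
    apply: cong_trans (FrP f) _ => //; rewrite efg; exact: cong_sym (FrP g).
  have := cong_exprB p_prime (L f) (L g) idJ Jp => h2.
  by have := idealD idJ h2 h; rewrite subrK.
have [f af] := red a; have /codomP[g eg] := injF_onto Fr_inj f.
exists (L g); apply: (@cong_trans _ _ idJ (L f)) => //.
by rewrite eg; exact: cong_sym (FrP g).
Qed.

End Unramified.

End NumberField.

(** * Uniqueness of Frobenius lifts and p-torsion under completion and localization *)

Section Completion.

Variables (p : nat) (p_prime : prime p).

Lemma pdvd_rmorph (A B : comNzRingType) (f : {rmorphism A -> B}) (k : nat) (a : A) :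
  pdvd p k a -> pdvd p k (f a).
Proof. by case=> b ->; exists (f b); rewrite rmorphM rmorphXn rmorph_nat. Qed.

Lemma completion_frobenius_surj (A : comNzRingType) (B : padicCompletion p A) :
    (forall a : A, exists b, pdvd p 1 (a - b ^+ p)) ->
  forall a : B, exists b, pdvd p 1 (a - b ^+ p).
Proof.
move=> surjA a; have [_ _ _ dense] := pc_axiom B.
have [a' aa'] := dense 1%N a; have [b a'b] := surjA a'; exists (pc_map B b).
apply: (cong_trans (is_ideal_pdvd p B 1) aa').
by rewrite /cong -rmorphXn -rmorphB; apply: pdvd_rmorph.
Qed.

(* If u = v mod p^k, then u (b^p) = v (b^p) mod p^(k+1), while every element is
   of the form b^p + p c. *)
Lemma rmorphism_eq_mod (A B : comNzRingType) (u v : {rmorphism A -> B}) :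
    (forall a : A, exists b, pdvd p 1 (a - b ^+ p)) -> padic_separated p B ->
  (forall a, pdvd p 1 (u a - v a)) -> u =1 v.
Proof.
move=> surjA sepB uv a; apply/eqP; rewrite -subr_eq0; apply/eqP/sepB.
suff uvk k : forall a, pdvd p k.+1 (u a - v a).
  by case=> [|k]; [exists (u a - v a); rewrite expr0 mul1r | apply: uvk].
elim: k => [//|k IH] {}a.
have [b [c]] := surjA a; rewrite expr1 => /eqP; rewrite subr_eq => /eqP ->.
rewrite !rmorphD !rmorphM !rmorphXn !rmorph_nat.
have [e ue] := IH c; have [f uf] := IH b.
have {}ue : u c = v c + p%:R ^+ k.+1 * e by rewrite -ue addrC subrK.
have {}uf : u b = v b + p%:R ^+ k.+1 * f by rewrite -uf addrC subrK.
rewrite ue uf; have [w ->] := exprD_prime p_prime (v b) (p%:R ^+ k.+1 * f).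
have [l pl] : exists l, p = l.+2 by case: p p_prime => [|[|l]] //; exists l.
exists (e + p%:R ^+ k * (p%:R ^+ k.+1) ^+ l * f ^+ p + v b * f * w).
have -> : (p%:R ^+ k.+1 * f) ^+ p =
    p%:R ^+ k.+2 * (p%:R ^+ k * (p%:R ^+ k.+1) ^+ l * f ^+ p).
  have expr_p (x : B) : x ^+ p = x * (x * x ^+ l) by rewrite pl !exprS.
  rewrite exprMn [_ ^+ _ ^+ p]expr_p; move: (_ ^+ l) (f ^+ p) => c1 c2.
  by rewrite !exprS; ring.
by move: (_ ^+ l) (f ^+ p) (v b ^+ p) => c1 c2 c3; rewrite !exprS; ring.
Qed.

(** This is p-torsion freeness of a ring, not the vanishing of the torsion of a connection. *)
Definition torsion_free_at (A : comNzRingType) : Prop :=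
  injective (fun a : A => p%:R * a).

Lemma torsion_free_atP (A : comNzRingType) :
  (forall a : A, p%:R * a = 0 -> a = 0) <-> torsion_free_at A.
Proof.
split=> [h a b /eqP|h a pa]; last by apply: h; rewrite pa mulr0.
by rewrite -subr_eq0 -mulrBr => /eqP/h/eqP; rewrite subr_eq0 => /eqP.
Qed.

(** If p b = 0 and a approximates b modulo p^k, then p a is divisible by p^(k+1) in B, hence in A,
    so p^k divides a and therefore b. Separatedness concludes. *)
Lemma completion_torsion_free (A : comNzRingType) (B : padicCompletion p A) :
  torsion_free_at A -> torsion_free_at B.
Proof.
move=> injA; apply/torsion_free_atP => b pb0; have [sep _ refl dense] := pc_axiom B.
apply: sep => k; have [a [c e]] := dense k b.
have eb : b = pc_map B a + p%:R ^+ k * c by rewrite -e addrC subrK.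
have /refl[a' ea] : pdvd p k.+1 (pc_map B (p%:R * a)).
  exists (- c); rewrite rmorphM rmorph_nat exprSr.
  apply/eqP; rewrite mulrN -subr_eq0 opprK -mulrA (mulrCA _ p%:R) -mulrDr -eb.
  by rewrite pb0.
have a_eq : a = p%:R ^+ k * a' by apply: injA; rewrite ea exprS mulrA.
rewrite eb a_eq; exists (pc_map B a' + c).
by rewrite rmorphM rmorphXn rmorph_nat mulrDr.
Qed.

Lemma localization_torsion_free (A B : comNzRingType) (S : set A)
    (f : {rmorphism A -> B}) :
  is_localization S f -> torsion_free_at A -> torsion_free_at B.
Proof.
move=> [unitS fracS kerS] /torsion_free_atP injA; apply/torsion_free_atP => b pb0.
have [a [s [Ss e]]] := fracS b.
have [|t St ta0] := kerS (p%:R * a).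
  by rewrite rmorphM rmorph_nat -e mulrA pb0 mul0r.
have ta : t * a = 0 by apply: injA; rewrite mulrCA.
have [c tc] := unitS t St; have [d sd] := unitS s Ss.
have fa0 : f a = 0 by rewrite -[f a]mul1r -tc mulrAC -rmorphM ta rmorph0 mul0r.
by rewrite -[b]mulr1 -sd mulrA e fa0 mul0r.
Qed.

Lemma mpoly_torsion_free (A : comNzRingType) (m : nat) :
  torsion_free_at A -> torsion_free_at {mpoly A[m]}.
Proof.
move=> injA f g /= e; apply/mpolyP => u; apply: injA => /=.
have := congr1 (mcoeff u) e; rewrite !mulr_natl !mcoeffMn.
by [].
Qed.

Lemma padicGL_torsion_free (N : nat) (A : comNzRingType) (G : padicGL p N A) :
  torsion_free_at A -> torsion_free_at G.
Proof.
move=> injA; apply: completion_torsion_free.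
apply: localization_torsion_free (gl_axiom G) _.
exact: mpoly_torsion_free.
Qed.

End Completion.

(** * The localization of O_F at a prime above p *)

Section LocalRing.

Variables (F : splittingFieldType rat) (p : nat) (p_prime : prime p).
Variables (P : prime_idealr (OF F)) (P_p : p%:R \in (P : {pred OF F})).

Lemma locOF_torsion_free : torsion_free_at p (locOF P).
Proof.
apply/torsion_free_atP => a /(congr1 val); rewrite rmorphM rmorph_nat rmorph0.
move/eqP; rewrite mulf_eq0 natr_alg_eq0 eqn0Ngt prime_gt0 //= => /eqP a0.
exact: val_inj.
Qed.

Lemma mem_loc_integers (u v : OF F) :
  v \notin (P : {pred OF F}) -> val u / val v \in loc_integers P.
Proof. by move=> vP; apply/asboolP; exists u, v. Qed.

Lemma val_OF_neq0 (v : OF F) : v \notin (P : {pred OF F}) -> val v != 0.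
Proof. by apply: contraNneq => v0; rewrite (_ : v = 0) ?rpred0 //; apply: val_inj. Qed.

Lemma prime_idealX (v : OF F) (k : nat) :
  v \notin (P : {pred OF F}) -> v ^+ k \notin (P : {pred OF F}).
Proof.
move=> vP; elim: k => [|k IH]; first by rewrite expr0 idealr1.
by rewrite exprS prime_idealrM negb_or vP.
Qed.

Lemma locOF_frobenius_surj :
    (forall a : OF F, exists b, pdvd p 1 (a - b ^+ p)) ->
  forall a : locOF P, exists b, pdvd p 1 (a - b ^+ p).
Proof.
move=> surj [a aP]; have /asboolP[u [v [vP ea]]] := aP.
have [u' [u'' eu]] := surj u; have [v' [v'' ev]] := surj v.
have {}eu : u = u' ^+ p + p%:R * u'' by rewrite -[p%:R]expr1 -eu addrC subrK.
have {}ev : v = v' ^+ p + p%:R * v'' by rewrite -[p%:R]expr1 -ev addrC subrK.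
(* Otherwise v = v'^p + p v'' would lie in P, which contains p. *)
have v'P : v' \notin (P : {pred OF F}).
  apply: contra vP => v'P; rewrite ev -(prednK (prime_gt0 p_prime)) exprSr.
  by rewrite rpredD // ?[p.-1.+1%:R * _]mulrC idealMr // prednK // prime_gt0.
have vvP : v * v' ^+ p \notin (P : {pred OF F}).
  by rewrite prime_idealrM negb_or vP prime_idealX.
exists (MkLocOF (mem_loc_integers u' v'P)).
(* This is (u / v - (u' / v')^p) / p over the common denominator. *)
exists (MkLocOF (mem_loc_integers (u'' * v' ^+ p - v'' * u' ^+ p) vvP)).
apply: val_inj; rewrite expr1 rmorphB rmorphXn rmorphM rmorph_nat.
change (a - (val u' / val v') ^+ p =
  p%:R * (val (u'' * v' ^+ p - v'' * u' ^+ p) / val (v * v' ^+ p))).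
have v0 : OF_val v != 0 := val_OF_neq0 vP.
have v'p0 : OF_val v' ^+ p != 0 by rewrite expf_neq0 // val_OF_neq0.
rewrite ea expr_div_n !(rmorphB, rmorphM, rmorphXn) /=.
have -> : OF_val u = val u' ^+ p + p%:R * val u''.
  by rewrite -[LHS]/(val u) eu rmorphD rmorphM rmorphXn rmorph_nat.
move: v0 v'p0; have -> : OF_val v = val v' ^+ p + p%:R * val v''.
  by rewrite -[LHS]/(val v) ev rmorphD rmorphM rmorphXn rmorph_nat.
rewrite /=.
move: (OF_val v' ^+ p) (OF_val u' ^+ p) (OF_val u'') (OF_val v'') => x1 x2 x3 x4 y1 y2.
by field; rewrite y2 y1.
Qed.

End LocalRing.

(** * Conjugate primes and inversion of 2 *)

Section GaloisConjugates.

Variables (F : splittingFieldType rat) (p : nat) (p_prime : prime p).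

Lemma galOF_nat (s : gal_of {:F}) (m : nat) : galOF s m%:R = m%:R.
Proof. by rewrite -[m%:R]mulr1 galOF_natM -[1 in LHS](expr0 1) galOF_expr expr0. Qed.

Lemma gal_ideal_nat (s : gal_of {:F}) (P : prime_idealr (OF F)) (m : nat) :
  m%:R \in (P : {pred OF F}) -> m%:R \in (gal_ideal s P : {pred OF F}).
Proof. by move=> mP; rewrite mem_gal_ideal galOF_nat. Qed.

(** For odd p, 1 is p minus a multiple of 2, so 2 cannot lie in a prime containing p. *)
Lemma locOF_half (P : prime_idealr (OF F)) :
  odd p -> p%:R \in (P : {pred OF F}) -> exists w : locOF P, 2%:R * w = 1.
Proof.
move=> p_odd pP; have nP2 : (2%:R : OF F) \notin (P : {pred OF F}).
  apply/negP => P2; have : (1 : OF F) \in (P : {pred OF F}).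
    rewrite (_ : 1 = p%:R - p./2%:R * 2%:R); first by rewrite rpredB // idealMr.
    rewrite -natrM -{1}(odd_double_half p) p_odd natrD -muln2.
    by rewrite addrK.
  by rewrite idealr1.
exists (MkLocOF (mem_loc_integers 1 nP2)).
apply: val_inj; rewrite rmorphM rmorph_nat.
change (2%:R * ((val (1 : OF F)) / val (2%:R : OF F)) = val (1 : locOF P)).
rewrite rmorph_nat !rmorph1 mul1r divff //.
by rewrite natr_alg_eq0.
Qed.

End GaloisConjugates.

(** * Frobenius lifts on the formal group, and the final transport to one ring *)

Section FormalGroup.

Variables (p N : nat) (R : comUnitRingType) (G : padicGL p N R).

Lemma gl_cst_frob (dR : R -> R) (d : G -> G) (r : R) :
    (forall r, d (gl_cst G r) = gl_cst G (dR r)) ->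
  frob p d (gl_cst G r) = gl_cst G (frob p dR r).
Proof.
move=> dE; rewrite /frob dE /gl_cst.
by rewrite !(rmorphD, rmorphM, rmorphXn, rmorph_nat).
Qed.

(** Evaluate the metric condition at x: H x = x^t q x, and H applied to x^(p) is (H x)^(p). *)
Lemma metric_frob (dR : R -> R) (Q : 'M[R]_N) (d : G -> G) : metric_at dR Q d ->
  map_mx (frob p d) ((gl_x G)^T *m glQ G Q *m gl_x G)
    = mxpow p ((gl_x G)^T *m glQ G Q *m gl_x G).
Proof.
case=> H [phi0 [[_ Hx] [_ _ phi0x] e]]; rewrite -Hx; apply/matrixP => j k.
rewrite [LHS]mxE [in LHS]mxE [RHS]mxE [in RHS]mxE.
have := e (gl_x G j k); rewrite /= => ->; rewrite -rmorphXn; congr (H _).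
by have /matrixP/(_ j k) := phi0x; rewrite !mxE.
Qed.

End FormalGroup.

Theorem corollary3p4
  (F : splittingFieldType rat) (galF : galois 1 {:F})
  (M disc : int) (Hdisc : is_discriminant F disc)
  (M_even : (2 %| M)%Z) (disc_M : (disc %| M)%Z)
  (n : nat) (sigma : 'I_n.+1 -> gal_of {:F}) (Hsigma : vertical_gauge sigma)
  (p : nat) (p_prime : prime p) (p_M : ~~ (p%:Z %| M)%Z)
  (P : prime_idealr (OF F)) (P_p : p%:R \in (P : {pred OF F}))
  (q : 'M[F]_n.+1) (q_GL : GL_over (integers_inv M) q) (q_sym : q^T = q)
  (q_inv : forall i, map_mx (sigma i) q = q)
  (* the rings R_i, their p-derivations, and the isomorphisms R_1 -> R_i *)
  (R : forall i, padicCompletion p (locOF (gal_ideal (sigma i) P)))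
  (dR : forall i, R i -> R i) (dR_der : forall i, p_derivation p (@dR i))
  (sR : forall i, {rmorphism R ord0 -> R i})
  (sR_sigma : forall i a, a \in loc_integers (gal_ideal (sigma ord0) P) ->
     sR i (completion_emb (R ord0) a) = completion_emb (R i) (sigma i a))
  (* the completed coordinate rings, and the isomorphisms between them *)
  (G : forall i, padicGL p n.+1 (R i))
  (sG : forall i, {rmorphism G ord0 -> G i}) (sGV : forall i, G i -> G ord0)
  (sG_cst : forall i r, sG i (gl_cst (G ord0) r) = gl_cst (G i) (sR i r))
  (sG_x : forall i, map_mx (sG i) (gl_x (G ord0)) = gl_x (G i))
  (sGK : forall i, cancel (sG i) (@sGV i))
  (sGVK : forall i, cancel (@sGV i) (sG i))
  (* the vertical Levi-Civita connection *)
  (delta : forall i, G i -> G i)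
  (LC : Levi_Civita sGV dR (fun i => map_mx (completion_emb (R i)) q) delta) :
  let Q := fun i => map_mx (completion_emb (R i)) q in
  let Riem := Riemann sG sGV Q delta in
  let C := Cmx Q delta in
  let x := gl_x (G ord0) in
  let dq := map_mx (@delta ord0) (glQ (G ord0) (Q ord0)) in
  forall i j m k : 'I_n.+1,
    ideal_gen [:: p%:R]
      (Riem i j m k - 2%:R^-1 * (C i k + C j m - C j k - C i m) ^+ p)
    /\
    ideal_gen (p%:R :: [seq (x - 1%:M) a.1 a.2 | a : 'I_n.+1 * 'I_n.+1])
      (Riem i j m k -
       2%:R^-1 * (dq j k + dq i m - dq i k - dq j m) ^+ p).

Proof.
move=> Q Riem C x dq; case: LC => conn metr tors.
set A : comUnitRingType := G ord0.
have M2 : p != 2%N by apply: contraNneq p_M => ->.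
have p_odd : odd p by case: (even_prime p_prime) M2 => [->|].
have p_disc : ~~ (p%:Z %| disc)%Z by apply: contra p_M => /dvdz_trans; apply.
have P_pi i := gal_ideal_nat (sigma i) P_p.
have surjR : forall r : R ord0, exists b, pdvd p 1 (r - b ^+ p).
  apply: completion_frobenius_surj; apply: (locOF_frobenius_surj p_prime (P_pi _)).
  exact: (integers_frobenius_surj galF Hdisc p_prime p_disc).
have [q_unit qM _] := q_GL.
have q_loc i j k : q j k \in loc_integers (gal_ideal (sigma i) P).
  exact: integers_inv_loc p_prime p_M (P_pi i) (qM j k).
(* Vertical gauge invariance of q enters here. *)
have sRQ i j k : sR i (Q ord0 j k) = Q i j k.
  rewrite !mxE sR_sigma //; congr (completion_emb _ _).
  by have /matrixP/(_ j k) := q_inv i; rewrite mxE.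
have frobR i r : frob p (@dR i) (sR i r) = sR i (frob p (@dR ord0) r).
  have [f fE] := frob_rmorphism p_prime (dR_der i).
  have [g gE] := frob_rmorphism p_prime (dR_der ord0).
  rewrite -fE -gE.
  (* Both composites send a to the p-th power of its image modulo p, hence agree on R_1. *)
  apply: (rmorphism_eq_mod p_prime (u := f \o sR i) (v := sR i \o g)) => //.
    by case: (pc_axiom (R i)).
  move=> a /=; rewrite fE gE /frob rmorphD rmorphM rmorphXn rmorph_nat.
  exists (dR i (sR i a) - sR i (dR ord0 a)).
  by rewrite expr1; ring.
have frobG i r : frob p (@delta i) (gl_cst (G i) r) = gl_cst (G i) (frob p (@dR i) r).
  by apply: gl_cst_frob; case: (conn i).
have sVP i := rmorphism_inv (sGK i) (@sGVK i).
have phiP i : {f : {rmorphism A -> A} | f =1 phi_conj sG sGV delta i}.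
  have [g gE] := sVP i; have [f fE] := frob_rmorphism p_prime (conn i).1.
  by exists (g \o f \o sG i) => a; rewrite /= gE fE.
pose phi i : {rmorphism A -> A} := sval (phiP i).
have phiE i a : phi i a = sGV i (frob p (@delta i) (sG i a)) by apply: (svalP (phiP i)).
(* The derivative of x for the i-th connection, carried back to the first ring. *)
pose D i : 'M[A]_n.+1 := map_mx (@sGV i) (map_mx (@delta i) (gl_x (G i))).
pose q0 : 'M[A]_n.+1 := glQ (G ord0) (Q ord0).
have sGq i j k : sG i (q0 j k) = glQ (G i) (Q i) j k.
  by rewrite [q0 j k]mxE [RHS]mxE sG_cst sRQ.
have sGx i j k : sG i (x j k) = gl_x (G i) j k.
  by have /matrixP/(_ j k) := sG_x i; rewrite mxE.
have frobQ i j k : frob p (@delta i) (glQ (G i) (Q i) j k) =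
    sG i (frob p (@delta ord0) (q0 j k)).
  by rewrite [q0 j k]mxE [glQ _ _ j k]mxE !frobG sG_cst -frobR sRQ.
have q0_sym : q0^T = q0.
  apply/matrixP => j k; rewrite !mxE.
  by have /matrixP/(_ j k) := q_sym; rewrite mxE => ->.
have phi_q i : map_mx (phi i) q0 = mxpow p q0 + p%:R *: dq.
  apply/matrixP => j k; rewrite mxE phiE sGq frobQ sGK.
  by rewrite /frob [RHS]mxE [mxpow _ _ _ _]mxE; congr (_ + _); rewrite !mxE.
have phi_x i : map_mx (phi i) x = mxpow p x + p%:R *: D i.
  apply/matrixP => j k; rewrite mxE phiE sGx /frob.
  have [g gE] := sVP i; rewrite -gE rmorphD rmorphM rmorphXn rmorph_nat !gE.
  have -> : sGV i (gl_x (G i) j k) = x j k by rewrite -sGx sGK.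
  rewrite [RHS]mxE [mxpow _ _ _ _]mxE; congr (_ + _).
  by rewrite [RHS]mxE; congr (_ * _); rewrite [RHS]mxE [in RHS]mxE.
have sGxqx i : map_mx (sG i) (x^T *m q0 *m x) =
    (gl_x (G i))^T *m glQ (G i) (Q i) *m gl_x (G i).
  rewrite !map_mxM -map_trmx; congr (_ *m _ *m _); last exact: sG_x.
    by rewrite sG_x.
  by apply/matrixP => j k; rewrite mxE sGq.
have phi_metric i : map_mx (phi i) (x^T *m q0 *m x) = mxpow p (x^T *m q0 *m x).
  apply/matrixP => j k; rewrite mxE phiE [RHS]mxE.
  have /matrixP/(_ j k) := sGxqx i; rewrite [LHS]mxE => e.
  have /matrixP/(_ j k) := metric_frob (metr i); rewrite [LHS]mxE [RHS]mxE -e => ->.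
  by rewrite -rmorphXn sGK.
have phi_frob i : frobenius_lift p (phi i).
  move=> a; exists (sGV i (@delta i (sG i a))); rewrite phiE /frob.
  have [g gE] := sVP i; rewrite -gE rmorphD rmorphM rmorphXn rmorph_nat !gE.
  by rewrite sGK.
pose Gam i := (D i)^T *m (mxpow p q0 + p%:R *: dq) *m mxpow p x.
(* Through this identification, the vanishing of the torsion becomes the symmetry of [Gam] in its
   first two indices. *)
have GamE i j k : Gam i j k = sGV i (gamma (Q i) (@delta i) j k).
  apply: (can_inj (sGK i)); rewrite sGVK.
  suff <- : map_mx (sG i) (Gam i) = gamma (Q i) (@delta i) by rewrite [RHS]mxE.
  rewrite /Gam /gamma !map_mxM -map_trmx -(phi_q i); congr (_^T *m _ *m _).
  - by apply/matrixP => a b; rewrite !mxE sGVK.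
  - by apply/matrixP => a b; rewrite [LHS]mxE [in LHS]mxE phiE sGVK sGq [RHS]mxE.
  - by apply/matrixP => a b; rewrite [LHS]mxE [in LHS]mxE rmorphXn sGx [RHS]mxE.
have torsionless i j k : Gam i j k = Gam j i k by rewrite !GamE tors.
have injp : injective (fun a : A => p%:R * a).
  apply: padicGL_torsion_free => //; apply: completion_torsion_free.
  exact: locOF_torsion_free.
have unit2 : (2%:R : A) \is a GRing.unit.
  have [w w2] := locOF_half p_odd (P_pi ord0).
  have e : 2%:R * gl_cst (G ord0) (pc_map (R ord0) w) = 1.
    pose g : {rmorphism locOF _ -> A} :=
      pc_map (G ord0) \o (gl_loc (G ord0) \o (@mpolyC (n.+1 * n.+1) _ \o pc_map (R ord0))).
    by rewrite -[gl_cst _ _]/(g w) -(rmorph_nat g) -rmorphM w2 rmorph1.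
  by apply/unitrP; exists (gl_cst (G ord0) (pc_map (R ord0) w)); rewrite mulrC e.
move=> i j m k.
have R1 : cong (@pdvd p A 1) (Riem i j m k)
    (2%:R^-1 * (C i k + C j m - C j k - C i m) ^+ p).
  have [Phi ePhi cPhi] := curvature_cong p_prime phi_frob phi_x i j.
  (* Multiplication by p is injective, so [divp] recovers exactly the matrix Phi. *)
  have eR : curvature_mx sG sGV delta i j = Phi.
    apply/matrixP => a b; rewrite mxE /curvature -(svalP (phiP i)) -(svalP (phiP j)).
    rewrite -(svalP (phiP j)) -(svalP (phiP i)).
    have /matrixP/(_ a b) := ePhi; rewrite !mxE => ->.
    exact: Defs.divpK.
  rewrite /Riem /Riemann eR -mulnn.
  exact: (Riemann_cong p_prime unit2 injp q0_sym phi_x phi_q phi_metric torsionless).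
split; first exact/ideal_gen1.
set I := ideal_gen _.
have idI : is_ideal I := is_ideal_gen _.
have Ip : I p%:R by apply: mem_ideal_gen; rewrite inE eqxx.
have Ix a b : I ((x - 1%:M) a b).
  apply: mem_ideal_gen; rewrite inE; apply/orP; right.
  by apply/mapP; exists (a, b); rewrite ?mem_enum.
have Cdq a b : cong I (C a b) (- dq a b).
  exact: (Cmx_cong p_prime injp).
have R2 : cong I (Riem i j m k) (2%:R^-1 * (C i k + C j m - C j k - C i m) ^+ p).
  exact: pdvd1_ideal R1.
apply: (cong_trans idI R2); apply: congM => //; first exact: cong_refl.
apply: congX => //.
(* The signs are reversed because C is congruent to -dq. *)
have -> : dq j k + dq i m - dq i k - dq j m =
    - dq i k + - dq j m - - dq j k - - dq i m by ring.
by do !apply: congB => //; apply: congD.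
Qed.
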